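(* If $G$ is a cactus graph (a connected finite simple graph in which every two cycles are edge-disjoint), then $\operatorname{tlir}(G) \leq 2$.
   Context: Graphs are finite and simple. A total coloring of $G$ assigns a color to every vertex and every edge of $G$. For a color $c$ and a vertex $v$, the total $c$-degree of $v$ is the number of edges of color $c$ incident to $v$, plus $1$ if $v$ itself has color $c$ (plus $0$ otherwise). A total coloring is a locally irregular total coloring (TLIR coloring) if for every edge $uv$, letting $c$ be the color of $uv$, the total $c$-degrees of $u$ and $v$ are different (equivalently, each color class induces a locally irregular total graph, where vertices of that color are ''full'' and other endpoints of edges of that color are ''empty''). $\operatorname{tlir}(G)$ is the minimum number of colors in a TLIR coloring of $G$. *)

(* Defs.v *)
From mathcomp Require Import all_boot.
Set Implicit Arguments.
Unset Strict Implicit.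
Unset Printing Implicit Defensive.

Record sgraph := SGraph {
  vertex :> finType;
  adj : rel vertex;
  adj_sym : symmetric adj;
  adj_irr : irreflexive adj }.

Definition edge_set (G : sgraph) : {set {set G}} :=
  [set [set u; v] | u in G, v in G & adj u v].

Definition edge (G : sgraph) := {f : {set G} | f \in edge_set G}.

Definition connected (G : sgraph) := forall x y : G, connect (@adj G) x y.

(* The length bound excludes [:: x; y], which [ucycle] accepts when x and y
   are adjacent. *)
Definition gcycle (G : sgraph) (p : seq G) := 2 < size p /\ ucycle (@adj G) p.

Definition cycle_edges (G : sgraph) (p : seq G) : {set {set G}} :=
  [set [set x; next p x] | x in p].

(* A cycle, as a subgraph, is determined by its edge set; rotations and
   reversals of a sequence describe the same cycle, so "two cycles" means two
   cycles with different edge sets. *)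
Definition cactus (G : sgraph) :=
  connected G /\
  forall p q : seq G, gcycle p -> gcycle q ->
    cycle_edges p <> cycle_edges q -> [disjoint cycle_edges p & cycle_edges q].

Definition total_coloring (G : sgraph) (k : nat) := {ffun G + edge G -> 'I_k}.

Definition total_degree (G : sgraph) (k : nat) (phi : total_coloring G k)
    (c : 'I_k) (v : G) : nat :=
  #|[set f : edge G | (v \in val f) && (phi (inr f) == c)]| + (phi (inl v) == c).

Definition is_tlir (G : sgraph) (k : nat) (phi : total_coloring G k) : bool :=
  [forall f : edge G, forall u : G, forall v : G, (val f == [set u; v]) ==>
    (total_degree phi (phi (inr f)) u != total_degree phi (phi (inr f)) v)].

Definition tlir_colorable (G : sgraph) (k : nat) : bool :=
  [exists phi : total_coloring G k, is_tlir phi].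

Lemma edgeP (G : sgraph) (f : edge G) :
  exists u v, val f = [set u; v] /\ u != v.
Proof.
case: f => f /= /imset2P[u v _]; rewrite inE => uv ->.
exists u, v; split=> //; apply/eqP=> e; by rewrite e adj_irr in uv.
Qed.

(* Give the vertices pairwise distinct colors, and each edge the color of one
   of its ends: every color class is then a star with full center and empty
   leaves. *)
Lemma tlir_colorable_ex (G : sgraph) : exists k, tlir_colorable G k.
Proof.
have /fin_all_exists[m Hm] (f : edge G) : exists x, x \in val f.
  by have [u [v [-> _]]] := edgeP f; exists u; rewrite !inE eqxx.
pose phi : total_coloring G #|G| :=
  [ffun z => match z with inl v => enum_rank v | inr f => enum_rank (m f) end].
have phil v : phi (inl v) = enum_rank v by rewrite ffunE.
have phir f : phi (inr f) = enum_rank (m f) by rewrite ffunE.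
have key f u v : val f = [set u; v] -> u != v -> m f = u ->
    total_degree phi (enum_rank u) v < total_degree phi (enum_rank u) u.
  move=> fE uv mf; rewrite /total_degree !phil eqxx.
  rewrite (inj_eq enum_rank_inj) eq_sym (negbTE uv) addn0 addn1 ltnS.
  apply: subset_leq_card; apply/subsetP=> g; rewrite !inE phir.
  rewrite (inj_eq enum_rank_inj) => /andP[_ /eqP mg].
  by rewrite -mg Hm eqxx.
exists #|G|; apply/existsP; exists phi.
apply/forallP=> f; apply/forallP=> u; apply/forallP=> v.
apply/implyP=> /eqP fE.
have uv : u != v.
  have [a [b [abE ab]]] := edgeP f.
  by apply/eqP=> e; move: (cards2 a b); rewrite -abE fE e setUid cards1 ab.
have := Hm f; rewrite fE !inE phir neq_ltn => /orP[]/eqP mf; rewrite mf.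
  by rewrite (key f u v) ?orbT.
by rewrite (key f v u) // 1?eq_sym // fE setUC.
Qed.

Definition tlir (G : sgraph) : nat := ex_minn (tlir_colorable_ex G).

(* Main.v *)
(* The two total degrees of a vertex [v] sum to [deg v + 1], and the colour of
   [v] decides the parity of one of them, hence of both. Prescribe parities [p]
   for colour [true]. An edge whose ends have degrees of different parity then
   sees different parities in exactly one colour: give it that colour. Let [H]
   consist of the other edges; those on which [p] differs may be coloured
   arbitrarily. Let [p] be the parity of the distance to a root in each
   component of [H]. The edges of [H] on which [p] agrees join vertices at the
   same distance, and in a cactus they form a matching, because two such edges
   [u v] and [u v'] would close two cycles through the edge from [u] to its
   parent. Treat them one by one, farthest first: recolouring [u v] and the edge
   from [u] to its parent [w] makes the total degrees at [u] and [v] differ, and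
   besides [u] and [v] it only affects [w], which is nearer to the root. *)

Require Import Defs.
From mathcomp Require Import all_boot.

Set Implicit Arguments.
Unset Strict Implicit.
Unset Printing Implicit Defensive.

(** * Unordered pairs *)

Lemma set2_inj (T : finType) (a x y : T) : [set a; x] = [set a; y] -> x = y.
Proof.
move=> /setP E; have := E x; have := E y; rewrite !inE !eqxx !orbT.
by move=> /orP[/eqP->|/eqP->//] /esym/orP[] /eqP.
Qed.

Lemma set2_eq (T : finType) (x y u v : T) :
  [set x; y] = [set u; v] -> x = u /\ y = v \/ x = v /\ y = u.
Proof.
move=> E; have: x \in [set u; v] by rewrite -E !inE eqxx.
rewrite !inE => /orP[]/eqP xE; [left|right]; split=> //; apply: (@set2_inj _ x).
  by rewrite E xE.
by rewrite E xE setUC.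
Qed.

(** * Breadth-first forests *)

(** For symmetric [e] the clauses make [lev] the distance to the unique vertex of level 0 in each
    component; at such a root [par] is unconstrained. *)
Definition bfs (T : finType) (e : rel T) (lev : T -> nat) (par : T -> T) :=
  [/\ forall x y, e x y -> lev y <= (lev x).+1,
      forall x, 0 < lev x -> e x (par x) /\ lev x = (lev (par x)).+1 &
      forall x y, connect e x y -> lev x = 0 -> lev y = 0 -> x = y].

(** Take for [lev x] the length of a shortest path from [root e x]; the last vertex but one of such
    a path can serve as [par x]. *)
Lemma exists_bfs (T : finType) (e : rel T) : symmetric e ->
  exists lev par, bfs e lev par.
Proof.
move=> e_sym; have csym := sym_connect_sym e_sym.
pose P x n := [exists p : n.-tuple T, path e (root e x) p && (last (root e x) p == x)].
have PI x p : path e (root e x) p -> last (root e x) p = x -> P x (size p).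
  by move=> pp lp; apply/existsP; exists (in_tuple p); rewrite pp lp eqxx.
have exP x : exists n, P x n.
  have : connect e (root e x) x by rewrite csym connect_root.
  by case/connectP=> p pp lp; exists (size p); apply: PI.
pose lev x := ex_minn (exP x).
have levP x : exists p, [/\ path e (root e x) p, last (root e x) p = x & size p = lev x].
  rewrite /lev; case: ex_minnP => n /existsP[p /andP[pp /eqP lp]] _.
  by exists p; rewrite size_tuple.
have lev_min x p : path e (root e x) p -> last (root e x) p = x -> lev x <= size p.
  by move=> pp lp; rewrite /lev; case: ex_minnP => n _; apply; apply: PI.
have rootE x y : e x y -> root e x = root e y.
  by move=> xy; apply/(rootP csym)/connect1.
have lip x y : e x y -> lev y <= (lev x).+1.
  move=> xy; have [p [pp lp <-]] := levP x.
  rewrite -(size_rcons p y); apply: lev_min; rewrite -(rootE x y) //.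
    by rewrite rcons_path pp lp.
  by rewrite last_rcons.
have exq x : exists y, 0 < lev x -> e x y /\ lev x = (lev y).+1.
  have [p [pp lp sp]] := levP x.
  case/lastP: p pp lp sp => [|p z] pp lp sp; first by exists x; rewrite -sp.
  move: pp lp sp; rewrite rcons_path last_rcons size_rcons => /andP[pp lz] zx sp.
  exists (last (root e x) p) => _; rewrite zx in lz.
  split; first by rewrite e_sym.
  apply/eqP; rewrite eqn_leq lip //= -sp ltnS; apply: lev_min; rewrite (rootE _ _ lz) //.
have [par parP] := fin_all_exists exq.
exists lev, par; split=> // x y /(rootP csym) rxy lx ly.
have root0 z : lev z = 0 -> z = root e z.
  by move=> z0; have [[|a p] [_ lp]] := levP z; rewrite z0 // -[LHS]lp.
by rewrite (root0 x) // (root0 y).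
Qed.

(* The cycle closed by a horizontal edge [u v] runs up the two branches of the
   tree, so apart from [u] and [v] it only uses vertices of smaller level. *)
Lemma bfs_path (T : finType) (e : rel T) lev par (u v : T) :
  symmetric e -> bfs e lev par -> connect e u v -> lev u = lev v -> u != v ->
  exists q, [/\ path e u (rcons (par u :: q) v), uniq (par u :: q) &
                all (fun x => lev x < lev u) (par u :: q)].
Proof.
move=> e_sym [_ up base]; have [k] := ubnP (lev u).
elim: k u v => // k IH u v uk uv luv nuv.
have lu : 0 < lev u.
  by rewrite lt0n; apply/negP=> /eqP l0; case/eqP: nuv; apply: base; rewrite -?luv.
have [epu lpu] := up u lu; have [epv lpv] := up v (leq_trans lu (eq_leq luv)).
have epv' : e (par v) v by rewrite e_sym.
have lpp : lev (par u) = lev (par v).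
  by move: luv; rewrite lpu lpv => -[].
have [pp|npp] := eqVneq (par u) (par v).
  by exists [::]; rewrite /= epu pp epv' -pp lpu leqnn.
have [||q [pq uq aq]] := IH (par u) (par v) _ _ lpp npp.
- by rewrite -ltnS -lpu.
- apply: connect_trans (connect_trans uv (connect1 epv)).
  by apply: connect1; rewrite e_sym.
exists (rcons (par (par u) :: q) (par v)); split.
- have step : path e u (par u :: rcons (par (par u) :: q) (par v)) by apply/andP.
  by rewrite rcons_path step /= last_rcons.
- have nin x : lev x = lev (par u) -> x \notin par (par u) :: q.
    by move=> lx; apply/negP=> /(allP aq); rewrite lx ltnn.
  rewrite cons_uniq rcons_uniq uq mem_rcons inE (negbTE npp) /=.
  by rewrite -!/(_ \in _ :: _) !nin.
apply/allP => x; rewrite inE mem_rcons inE lpu ltnS.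
by move=> /or3P[/eqP->|/eqP->|/(allP aq)/ltnW]; rewrite -?lpp.
Qed.

Lemma horizontal_matching (G : sgraph) (e : rel G) lev par (u v v' : G) :
  cactus G -> symmetric e -> subrel e (@adj G) -> bfs e lev par ->
  e u v -> e u v' -> lev u = lev v -> lev u = lev v' -> v = v'.
Proof.
move=> [_ disj] e_sym sub bf.
have cyc x : e u x -> lev u = lev x -> exists p : seq G,
    [/\ gcycle p, [set u; par u] \in cycle_edges p, x \in p &
        {in p, forall y, [\/ y = u, y = x | lev y < lev u]}].
  move=> ux lx; have nux : u != x by apply/eqP=> E; move: (sub _ _ ux); rewrite -E adj_irr.
  have [q [pq uq aq]] := bfs_path e_sym bf (connect1 ux) lx nux.
  have nin y : lev u = lev y -> y \notin par u :: q.
    by move=> ly; apply/negP=> /(allP aq); rewrite ly ltnn.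
  exists (u :: rcons (par u :: q) x); split.
  - split; first by rewrite /= size_rcons.
    rewrite /ucycle /ucycleb cons_uniq mem_rcons inE (negbTE nux) rcons_uniq uq.
    rewrite !nin // andbT /cycle rcons_path last_rcons (sub x u) 1?e_sym //.
    by rewrite !andbT; apply: sub_path pq.
  - by apply/imsetP; exists u; [apply: mem_head|rewrite /= eqxx].
  - by rewrite inE mem_rcons mem_head orbT.
  move=> y; rewrite inE mem_rcons inE => /or3P[/eqP->|/eqP->|/(allP aq)].
  + by constructor 1.
  + by constructor 2.
  + by constructor 3.
move=> uv uv' lv lv'; apply/eqP/negPn/negP=> nvv.
have [p [gp ep vp _]] := cyc v uv lv; have [p' [gp' ep' _ lp']] := cyc v' uv' lv'.
(* [v] lies on [p] but not on [p'], whose only vertices of level at least [lev u] are [u] and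
   [v']. *)
have dp : cycle_edges p <> cycle_edges p'.
  move=> E; have : [set v; next p v] \in cycle_edges p by apply: imset_f.
  rewrite E => /imsetP[z zp' /setP/(_ v)]; rewrite !inE eqxx /= => /esym vz.
  have vp' : v \in p' by case/orP: vz => /eqP ->; rewrite ?mem_next.
  case: (lp' v vp') => [E1|/eqP|]; last by rewrite lv ltnn.
    by move: (sub _ _ uv); rewrite E1 adj_irr.
  by rewrite (negbTE nvv).
by move/disjointFr: (disj _ _ gp gp' dp) => /(_ _ ep); rewrite ep'.
Qed.

(** * Degrees with prescribed parities *)

Definition deg (G : sgraph) (v : G) := #|[set x | adj v x]|.

Definition color_deg (G : sgraph) (ec : {set G} -> bool) (c : bool) (v : G) :=
  #|[set x | adj v x && (ec [set v; x] == c)]|.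

(* The least number of parity [t c v] that is at least the number of [c]-edges
   at [v]. *)
Definition full_deg (G : sgraph) (t : bool -> G -> bool) (ec : {set G} -> bool)
    (c : bool) (v : G) :=
  color_deg ec c v + (odd (color_deg ec c v) (+) t c v).

(* As the two total degrees of [v] sum to [deg v + 1], both of them have their
   prescribed parity for one and the same choice of the colour of [v]. *)
Definition parity_target (G : sgraph) (t : bool -> G -> bool) :=
  forall v, t true v (+) t false v = ~~ odd (deg v).

Lemma color_degD (G : sgraph) (ec : {set G} -> bool) (v : G) :
  color_deg ec true v + color_deg ec false v = deg v.
Proof.
rewrite /deg -(cardsID [set x | ec [set v; x]]); congr (_ + _).
  by apply: eq_card => x; rewrite !inE eqb_id.
by apply: eq_card => x; rewrite !inE eqbF_neg andbC.
Qed.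

Lemma full_deg_eq (G : sgraph) t (ec ec' : {set G} -> bool) c v :
  (forall x, adj v x -> ec [set v; x] = ec' [set v; x]) ->
  full_deg t ec c v = full_deg t ec' c v.
Proof.
move=> E; rewrite /full_deg; suff -> : color_deg ec c v = color_deg ec' c v by [].
by apply: eq_card => x; rewrite !inE; case: (boolP (adj v x)) => //= /E ->.
Qed.

Lemma odd_full_deg (G : sgraph) t (ec : {set G} -> bool) c v :
  odd (full_deg t ec c v) = t c v.
Proof. by rewrite /full_deg oddD oddb addKb. Qed.

(* For exactly one colour [c] the number of [c]-edges at [u], counted with
   [u v] but without [u w], has the target parity at [u]; once [u v] is
   coloured [c], the choice of the colour of [u w] moves the degree by 2. *)
Lemma recolor (G : sgraph) (t : bool -> G -> bool) (ec : {set G} -> bool)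
    (u v w : G) :
  parity_target t -> adj u v -> adj u w -> v != w ->
  exists ec', (forall E, E != [set u; v] -> E != [set u; w] -> ec' E = ec E) /\
    full_deg t ec' (ec' [set u; v]) u != full_deg t ec' (ec' [set u; v]) v.
Proof.
move=> tp uv uw vw.
pose n c := #|[set x | [&& adj u x, x != v, x != w & ec [set u; x] == c]]|.
pose ec1 c b E :=
  if E == [set u; v] then c else if E == [set u; w] then b else ec E.
have wv : [set u; w] == [set u; v] = false.
  by apply/negP=> /eqP/set2_inj E; rewrite E eqxx in vw.
have ec1v c b : ec1 c b [set u; v] = c by rewrite /ec1 eqxx.
have ec1w c b : ec1 c b [set u; w] = b by rewrite /ec1 wv eqxx.
have ec1x c b x : x != v -> x != w -> ec1 c b [set u; x] = ec [set u; x].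
  move=> xv xw; rewrite /ec1 !ifN //.
    by apply: contra_neq xw; apply: set2_inj.
  by apply: contra_neq xv; apply: set2_inj.
have degE c b d : color_deg (ec1 c b) d u = n d + (c == d) + (b == d).
  rewrite /color_deg (cardsD1 v) (cardsD1 w) !inE uv uw ec1v ec1w (eq_sym w v) vw /=.
  rewrite addnA addnC addnA; congr (_ + _ + _); apply: eq_card => x; rewrite !inE.
  have [->|xw] := eqVneq x w; first by rewrite /= !andbF.
  have [->|xv] := eqVneq x v; first by rewrite /= !andbF.
  by rewrite ec1x.
(* [n true + n false] is [deg u - 2], whereas the targets at [u] sum to the opposite parity; so the
   parity of [n] agrees with the target in one colour and differs from it in the other. *)
have oddn (c : bool) : odd (n true) (+) odd (n false) = odd (deg u).
  by rewrite -(color_degD (ec1 c c)) !degE !oddD; case: c;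
    case: (odd (n true)); case: (odd (n false)).
have [c nc] : exists c, odd (n c).+1 = t c u.
  have [E|E] : odd (n true).+1 = t true u \/ odd (n false).+1 = t false u.
    have := oddn true; have := tp u => /=.
    case: (t true u) (t false u) (odd (n true)) (odd (n false)) (odd (deg u)).
      by case; case; case; case; auto.
    by case; case; case; case; auto.
  - by exists true.
  - by exists false.
(* If [b] is not [c], the count [(n c).+1] already has the target parity; if [b = c], the count
   [(n c).+2] is rounded up to [(n c).+3]. *)
have fu b : full_deg t (ec1 c b) c u = (n c).+1 + (b == c).*2.
  rewrite /full_deg degE -nc eqxx /= addn1.
  by case: (b == c); rewrite /= ?addn1 ?addn0 /= ?addbb; case: (odd (n c)); rewrite /= ?addnS ?addn0.
have fv b : full_deg t (ec1 c b) c v = full_deg t (ec1 c c) c v.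
  apply: full_deg_eq => x vx; rewrite /ec1; case: ifP => // _.
  case: ifP => // /eqP/setP/(_ v); rewrite !inE eqxx /= (negbTE vw) orbF.
  by move=> /esym/eqP E; rewrite -E adj_irr in uv.
(* The degree of [v] does not depend on [b], so a tie for [b = c] is broken by [b = ~~ c]. *)
have [E|N] := eqVneq (full_deg t (ec1 c c) c u) (full_deg t (ec1 c c) c v).
  exists (ec1 c (~~ c)); split; first by move=> X; rewrite /ec1 => /negbTE-> /negbTE->.
  rewrite ec1v fv -E !fu eqxx; case: (c) => /=; by rewrite addn0 addn2 neq_ltn leqnSn.
exists (ec1 c c); split; last by rewrite ec1v.
by move=> X; rewrite /ec1 => /negbTE-> /negbTE->.
Qed.

Lemma card_incident (G : sgraph) (Q : pred {set G}) (v : G) :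
  #|[set f : edge G | (v \in val f) && Q (val f)]| =
  #|[set x | adj v x && Q [set v; x]]|.
Proof.
rewrite -(card_imset _ val_inj) -[RHS](card_imset _ (@set2_inj _ v)).
apply: eq_card => E; apply/imsetP/imsetP => [[f]|[x]]; rewrite !inE.
  case/andP=> vf Qf ->; have := valP f; move: vf Qf.
  move: (val f) => F vF QF /imset2P[a b _]; rewrite inE => /andP[_ ab] EF.
  have [vE|vE] : v = a \/ v = b by move: vF; rewrite EF !inE => /orP[]/eqP; auto.
    by exists b; rewrite ?inE vE // ab -EF.
  by exists a; rewrite ?inE vE setUC // adj_sym ab -EF.
case/andP=> vx Qx ->.
have F : [set v; x] \in edge_set G by apply/imset2P; exists v x; rewrite ?inE.
by exists (Sub [set v; x] F); rewrite ?inE SubK ?eqxx.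
Qed.

(** A vertex gets colour [true] exactly when its number of [true]-edges misses the target parity; by
    [parity_target] it then gets colour [false] exactly when its number of [false]-edges does. *)
Lemma tlir_le2_full_deg (G : sgraph) (t : bool -> G -> bool) (ec : {set G} -> bool) :
  parity_target t ->
  (forall u v, adj u v ->
    full_deg t ec (ec [set u; v]) u != full_deg t ec (ec [set u; v]) v) ->
  tlir G <= 2.
Proof.
move=> tp good; rewrite /tlir; case: ex_minnP => m _; apply.
pose col (b : bool) : 'I_2 := inord b.
have col_inj : injective col.
  by move=> b b' /(congr1 val); rewrite /= !inordK //; case: b; case: b'.
pose vc v := odd (color_deg ec true v) (+) t true v.
pose phi : total_coloring G 2 :=
  [ffun z => match z with inl v => col (vc v) | inr f => col (ec (val f)) end].
have degE c v : total_degree phi (col c) v = full_deg t ec c v.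
  rewrite /total_degree /full_deg ffunE (inj_eq col_inj); congr (_ + _).
    apply: etrans (card_incident (fun E => ec E == c) v).
    by apply: eq_card => f; rewrite !inE ffunE (inj_eq col_inj).
  congr nat_of_bool; rewrite /vc; have := tp v; rewrite -(color_degD ec v) oddD.
  by case: c; case: (t true v); case: (t false v);
    case: (odd (color_deg ec true v)); case: (odd (color_deg ec false v)).
apply/existsP; exists phi; apply/forallP=> f; apply/forallP=> u; apply/forallP=> v.
apply/implyP=> /eqP fE; rewrite ffunE !degE fE; apply: good.
have := valP f; rewrite fE => /imset2P[a b _]; rewrite inE => /andP[_ ab].
by move=> /set2_eq[] [-> ->] //; rewrite adj_sym.
Qed.

(** * The coloring of a cactus *)

Theorem theorem1 (G : sgraph) (hG : cactus G) : tlir G <= 2.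
Proof.
(* [e] is the graph [H]: across any other edge the targets [t] chosen below differ in exactly one
   colour. *)
pose e : rel G := fun x y => adj x y && (odd (deg x) == odd (deg y)).
have e_sym : symmetric e by move=> x y; rewrite /e adj_sym eq_sym.
have esub : subrel e (@adj G) by move=> x y /andP[].
have [lev [par bf]] := exists_bfs e_sym.
have match_ u v v' := @horizontal_matching G e lev par u v v' hG e_sym esub bf.
have [lip up base] := bf.
pose t c v := odd (lev v) (+) (~~ c && ~~ odd (deg v)).
have tp : parity_target t by move=> v; rewrite /t /= addbF addKb.
have eparity u v : e u v -> lev u != lev v -> forall c, t c u != t c v.
  move=> uv luv c; rewrite /t; have /andP[_ /eqP ->] := uv.
  have vu : e v u by rewrite e_sym.
  have [l|l] : lev u = (lev v).+1 \/ lev v = (lev u).+1.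
    have := lip _ _ uv; have := lip _ _ vu; move: luv; rewrite neq_ltn.
    by case/orP=> l l1 l2; [right|left]; apply/eqP; rewrite eqn_leq ?l ?l1 ?l2.
  - by rewrite l /=; case: odd; case: (_ && _).
  - by rewrite l /=; case: odd; case: (_ && _).
pose forced (ec : {set G} -> bool) := forall u v, adj u v -> ~~ e u v ->
  t (ec [set u; v]) u != t (ec [set u; v]) v.
pose good (ec : {set G} -> bool) u v :=
  full_deg t ec (ec [set u; v]) u != full_deg t ec (ec [set u; v]) v.
have goodC ec u v : good ec u v = good ec v u by rewrite /good setUC eq_sym.
pose hor := [set z : G * G | e z.1 z.2 && (lev z.1 == lev z.2)].
have [ec fec hec] : exists2 ec, forced ec & {in hor, forall z, good ec z.1 z.2}.
  suff step n (S : {set G * G}) : S \subset hor -> #|S| < n ->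
      exists2 ec, forced ec & {in S, forall z, good ec z.1 z.2}.
    exact: (step #|hor|.+1 hor).
  elim: n S => // n IH S sS nS.
  have [S0|[z0 z0S]] := set_0Vmem S.
    (* This gives each edge outside [e] its forced colour; on [e] any colours would do. *)
    pose ec (E : {set G}) := [exists x in E, exists y in E, t true x != t true y].
    exists ec; last by rewrite S0 => z; rewrite inE.
    move=> u v uv; rewrite /e uv /= => duv.
    case E: (ec [set u; v]).
      case/existsP: E => x /andP[xE /existsP[y /andP[yE]]].
      by move: xE yE; rewrite !inE => /orP[]/eqP-> /orP[]/eqP->; rewrite ?eqxx // eq_sym.
    have := E; apply: contraFneq => tuv; apply/existsP; exists u.
    rewrite !inE eqxx /=; apply/existsP; exists v; rewrite !inE eqxx orbT /=.
    move: duv tuv; rewrite /t /=.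
    by case: (odd (deg u)); case: (odd (deg v)); case: (odd (lev u)); case: (odd (lev v)).
  (* A pair of least level is recoloured last, so the remaining pairs of [S] all lie on higher
     levels than [w]. *)
  have [[u v] /= uvS umin] := @arg_minnP _ z0 [in S] (fun z => lev z.1) z0S.
  have [uv /eqP luv] : e u v /\ lev u == lev v.
    by have := subsetP sS _ uvS; rewrite inE => /andP[].
  have [||ec fec hec] := IH (S :\ (u, v)).
  - by apply: subset_trans sS; apply: subD1set.
  - by move: nS; rewrite (cardsD1 (u, v) S) uvS.
  have nuv : u != v by apply/eqP=> E; move: (esub _ _ uv); rewrite -E adj_irr.
  have lu : 0 < lev u.
    rewrite lt0n; apply/negP=> /eqP l0; case/eqP: nuv.
    by apply: base; rewrite -?luv //; apply: connect1.
  have [uw lw] := up u lu; set w := par u in uw lw.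
  have vw : v != w by apply/eqP=> E; move/eqP: lw; rewrite luv E -{1}[lev w]addn0 -addn1 eqn_add2l.
  have [ec' [ecE guv]] := recolor ec tp (esub _ _ uv) (esub _ _ uw) vw.
  exists ec'.
    (* Both recoloured edges lie in [e], so [forced] persists. *)
    move=> x y xy nxy; rewrite ecE; [exact: fec| |].
  - by apply: contraNneq nxy => /set2_eq[] [-> ->] //; rewrite e_sym.
  - by apply: contraNneq nxy => /set2_eq[] [-> ->] //; rewrite e_sym.
  move=> [x y] xyS; have := subsetP sS _ xyS; rewrite inE /= => /andP[xy /eqP lxy].
  have lux : lev u <= lev x := umin _ xyS.
  have [[-> ->]|nxy1] := eqVneq (x, y) (u, v); first exact: guv.
  have [[-> ->]|nxy2] := eqVneq (x, y) (v, u); first by rewrite goodC.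
  have vu : e v u by rewrite e_sym.
  have yx : e y x by rewrite e_sym.
  (* Since horizontal edges form a matching, [x] and [y] avoid [u] and [v]; with [low] no edge at
     [x] or [y] is recoloured. *)
  have xu : x != u.
    by apply: contra_neq nxy1 => xu; rewrite xu in xy lxy *; rewrite (match_ _ _ _ xy uv).
  have xv : x != v.
    by apply: contra_neq nxy2 => xv; rewrite xv in xy lxy *; rewrite (match_ _ _ _ xy vu).
  have yu : y != u.
    by apply: contra_neq nxy2 => yu; rewrite yu in yx lxy *; rewrite (match_ _ _ _ yx uv).
  have yv : y != v.
    by apply: contra_neq nxy1 => yv; rewrite yv in yx lxy *; rewrite (match_ _ _ _ yx vu).
  have low z : lev u <= lev z -> z != w.
    by apply: contraTneq => ->; rewrite lw ltnn.
  have off a b : a != u -> a != v -> lev u <= lev a -> ec' [set a; b] = ec [set a; b].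
    move=> au av la; apply: ecE; apply/eqP=> /set2_eq[] [E _].
    - by rewrite E eqxx in au.
    - by rewrite E eqxx in av.
    - by rewrite E eqxx in au.
    - by have := low a la; rewrite E eqxx.
  have offD a c : a != u -> a != v -> lev u <= lev a ->
      full_deg t ec' c a = full_deg t ec c a.
    by move=> au av la; apply: full_deg_eq => b _; apply: off.
  rewrite /good off // !offD -?lxy //; apply: (hec (x, y)).
  by rewrite !inE nxy1.
apply: (tlir_le2_full_deg tp (ec := ec)) => u v uv.
(* Outside [hor] the targets at the two ends differ in the colour of the edge: by [forced] off [e],
   by the levels on [e]. *)
case: (boolP (e u v)) => euv; last first.
  by apply: contraNneq (fec _ _ uv euv) => /(congr1 odd); rewrite !odd_full_deg => ->.
have [l|l] := eqVneq (lev u) (lev v).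
  by apply: (hec (u, v)); rewrite inE /= euv l eqxx.
by apply: contraNneq (eparity _ _ euv l (ec [set u; v])) => /(congr1 odd);
  rewrite !odd_full_deg => ->.
Qed.
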